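(* If $G$ is an $r$-regular graph of order $n$ with $3\le r\le \frac{n-1}{3}$, then the iterated line graphs $\mathcal{L}^k(\overline{G})$ of the complement $\overline{G}$ have property $\varrho$ for every $k\ge 1$.
   Context: $\overline{G}$ is the complement of $G$. $\mathcal{L}^k$ is the $k$-th iterated line graph. A graph has property $\varrho$ if all its negative adjacency eigenvalues equal $-2$. *)

(* Defs.v *)
From HB Require Import structures.
From mathcomp Require Import all_boot all_order all_algebra.
From mathcomp Require Import reals.
Set Implicit Arguments.
Unset Strict Implicit.
Unset Printing Implicit Defensive.
Import Order.TTheory GRing.Theory Num.Theory.
Local Open Scope ring_scope.

Record sgraph := SGraph {
  vertex :> finType;
  adj : rel vertex;
  adj_sym : symmetric adj;
  adj_irrefl : irreflexive adj }.

Definition regular (G : sgraph) (r : nat) : Prop :=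
  forall x : G, #|[set y | adj x y]| = r.

Section Complement.
Variable G : sgraph.

Definition compl_adj : rel G := [rel x y | (x != y) && ~~ adj x y].

Lemma compl_adj_sym : symmetric compl_adj.
Proof. by move=> x y; rewrite /compl_adj /= eq_sym adj_sym. Qed.

Lemma compl_adj_irrefl : irreflexive compl_adj.
Proof. by move=> x; rewrite /compl_adj /= eqxx. Qed.

Definition complement : sgraph := SGraph compl_adj_sym compl_adj_irrefl.

End Complement.

Section LineGraph.
Variable G : sgraph.

Definition edges : {set {set G}} :=
  [set [set x; y] | x in G, y in G & adj x y].

Definition edge : finType := {e : {set G} | e \in edges}.

Definition line_adj : rel edge :=
  [rel e f | (e != f) && (val e :&: val f != set0)].

Lemma line_adj_sym : symmetric line_adj.
Proof. by move=> e f; rewrite /line_adj /= eq_sym setIC. Qed.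

Lemma line_adj_irrefl : irreflexive line_adj.
Proof. by move=> e; rewrite /line_adj /= eqxx. Qed.

Definition line_graph : sgraph := SGraph line_adj_sym line_adj_irrefl.

End LineGraph.

Definition iterated_line_graph (k : nat) (G : sgraph) : sgraph :=
  iter k line_graph G.

Definition adjacency_matrix (R : realType) (G : sgraph) : 'M[R]_#|G| :=
  \matrix_(i, j) (adj (enum_val i) (enum_val j))%:R.

Definition property_rho (R : realType) (G : sgraph) : Prop :=
  forall a : R, eigenvalue (adjacency_matrix R G) a -> a < 0 -> a = -2.

(* Main.v *)
Require Import Defs.
From mathcomp Require Import all_boot all_order all_algebra.
From mathcomp Require Import reals.
From mathcomp Require Import zify lra.
Import Order.TTheory GRing.Theory Num.Theory.
Local Open Scope ring_scope.

(** Let [f] be an eigenvector of the line graph of a [d]-regular graph [K] for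
    the eigenvalue [a], and let [g x] be the sum of [f] over the edges at [x].
    Then [(a + 2) f e = g x + g y] for [e = {x, y}], and summing over the edges
    at [x] shows that [g] satisfies the eigenvector equation of [K] for
    [a + 2 - d].  Hence [a = -2], or [a + 2 - d] is an eigenvalue of [K]; so the
    line graph has property rho as soon as all eigenvalues of [K] are at least
    [2 - d].  For the complement of [G] this bound follows from the spectral
    radius of [G]; line graphs of regular graphs satisfy it from degree 4 on,
    since their eigenvalues are at least [-2]. *)

Lemma adj_neq {G : sgraph} {x y : G} : adj x y -> x != y.
Proof. by apply: contraTneq => ->; rewrite adj_irrefl. Qed.

(** Replaces row vectors indexed by ordinals with functions on vertices, so that later sums run over
    neighbours. Symmetry of [adj] absorbs the transposition. *)
Lemma eigenvalue_adjacencyP {R : realType} {G : sgraph} {a : R} :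
  eigenvalue (adjacency_matrix R G) a <->
  exists2 f : G -> R, exists x, f x != 0 &
    forall x, \sum_(y | adj x y) f y = a * f x.
Proof.
split.
  case/eigenvalueP => v va v0.
  exists (fun x => v 0 (enum_rank x)).
    have [i vi] : exists i, v 0 i != 0.
      apply/existsP; apply: contraNT v0; rewrite negb_exists => /forallP v0.
      apply/eqP/rowP => i; rewrite mxE; apply/eqP.
      by move: (v0 i); rewrite negbK.
    by exists (enum_val i); rewrite enum_valK.
  move=> x; move/rowP/(_ (enum_rank x)): va; rewrite !mxE => <-.
  rewrite (reindex _ (onW_bij _ (@enum_rank_bij G))) /= big_mkcond.
  apply: eq_bigr => y _; rewrite !mxE !enum_rankK adj_sym.
  by case: adj; rewrite ?mulr1 ?mulr0.
case=> f [x fx] fa; apply/eigenvalueP; exists (\row_i f (enum_val i)).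
  apply/rowP => j; rewrite !mxE -fa [RHS]big_mkcond /=.
  rewrite [RHS](reindex _ (onW_bij _ (@enum_val_bij G))) /=.
  apply: eq_bigr => i _; rewrite !mxE adj_sym.
  by case: adj; rewrite ?mulr1 ?mulr0.
apply: contraNneq fx => /rowP/(_ (enum_rank x)).
by rewrite !mxE enum_rankK => ->.
Qed.

Lemma sumr_adj_regular {V : nmodType} {G : sgraph} {r : nat} (c : V) (x : G) :
  regular G r -> \sum_(y | adj x y) c = c *+ r.
Proof.
by move=> /(_ x) <-; rewrite sumr_const; congr (_ *+ _); apply: eq_card => y; rewrite inE.
Qed.

(** Sending a neighbour [y] to [[set x; y]] is a bijection onto the edges at [x]. Taking [F] on all
    sets avoids carrying proofs of edge membership. *)
Lemma sum_incident_edges {V : nmodType} {G : sgraph} (F : {set G} -> V) (x : G) :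
  \sum_(e : edge G | x \in val e) F (val e) = \sum_(y | adj x y) F [set x; y].
Proof.
transitivity (\sum_(e in [set [set x; y] | y in [set y | adj x y]]) F e).
  rewrite -(big_sub_cond (mem (edges G)) (fun e => x \in e)) /=.
  apply: eq_bigl => e; apply/andP/imsetP => [[/imset2P[u v _]]|[y]].
    rewrite inE /= => uv -> /set2P[] ->; first by exists v; rewrite ?inE.
    by exists u; rewrite ?inE 1?adj_sym // setUC.
  rewrite inE => xy ->; split; last by rewrite !inE eqxx.
  by apply/imset2P; exists x y; rewrite ?inE.
rewrite big_imset /=; first by apply: eq_bigl => y; rewrite inE.
move=> y z; rewrite !inE => xy xz /setP/(_ y).
rewrite !inE eqxx orbT; case/esym/orP => /eqP // yx.
by move: xy; rewrite yx adj_irrefl.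
Qed.

Lemma card_edge {G : sgraph} (e : edge G) : #|val e| = 2%N.
Proof.
case: e => e /= /imset2P[x y _]; rewrite inE => /adj_neq xy ->.
by rewrite cards2 xy.
Qed.

Lemma card_edgeI {G : sgraph} {e e' : edge G} : e != e' ->
  #|val e :&: val e'| = (val e :&: val e' != set0).
Proof.
move=> ee'; rewrite -cards_eq0.
have : (#|val e :&: val e'| < 2)%N.
  rewrite -(card_edge e) ltn_neqAle subset_leq_card ?subsetIl // andbT.
  apply: contraNneq ee' => eI; apply/eqP/val_inj/eqP.
  rewrite eqEcard !card_edge leqnn andbT; apply/setIidPl/eqP.
  by rewrite eqEcard subsetIl eI leqnn.
by case: #|_| => [|[]].
Qed.

(** Double counting: [f e'] occurs once per vertex shared with [e], so twice for [e] itself. In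
    terms of the incidence matrix [B], this is [B^T B = A + 2 I], with [A] the adjacency matrix of
    the line graph. *)
Lemma sum_line_adj {V : nmodType} {G : sgraph} (f : line_graph G -> V)
    (e : line_graph G) :
  \sum_(x in val e) \sum_(e' : edge G | x \in val e') f e' =
    \sum_(e' | adj e e') f e' + f e *+ 2.
Proof.
rewrite (exchange_big_dep predT) //=.
under eq_bigr => e' _.
  rewrite sumr_const (_ : #|_| = #|val e :&: val e'|); last first.
    by apply: eq_card => x; rewrite !inE.
  over.
rewrite (bigD1 e) //= setIid card_edge addrC; congr (_ + _).
rewrite big_mkcond [RHS]big_mkcond; apply: eq_bigr => e' _.
rewrite /= /line_adj /= eq_sym; case: (boolP (e != e')) => //= ee'.
by rewrite (card_edgeI ee'); case: (_ != _).
Qed.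

Lemma line_graph_regular {G : sgraph} {d : nat} :
  regular G d -> regular (line_graph G) (d.*2 - 2).
Proof.
(* For the constant 1, the double count reads [2 d = deg e + 2]. *)
move=> Gd e; have := sum_line_adj (fun=> 1 : nat) e.
under eq_bigr => x _ do
  rewrite (sum_incident_edges (fun=> 1)) (sumr_adj_regular _ _ Gd).
rewrite !sumr_const card_edge -mulrnA !natn.
rewrite (_ : #|_| = #|[set e' | adj e e']|); last by apply: eq_card => e'; rewrite inE.
rewrite natrDE; lia.
Qed.

Definition eigenvalues_ge (R : realType) (G : sgraph) (b : R) : Prop :=
  forall a, eigenvalue (adjacency_matrix R G) a -> b <= a.

Lemma line_graph_eigenvalue {R : realType} {G : sgraph} {d : nat} {a : R} :
  regular G d -> eigenvalue (adjacency_matrix R (line_graph G)) a ->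
  a = -2 \/ eigenvalue (adjacency_matrix R G) (a + 2 - d%:R).
Proof.
move=> Gd /eigenvalue_adjacencyP[f [e fe] fa].
have [->|a2] := eqVneq a (-2); [by left | right].
pose g (x : G) : R := \sum_(e : edge G | x \in val e) f e.
have gE (e' : line_graph G) : \sum_(x in val e') g x = (a + 2) * f e'.
  by rewrite sum_line_adj fa mulrDl mulr_natl.
have a2_neq0 : a + 2 != 0 by rewrite addr_eq0.
apply/eigenvalue_adjacencyP; exists g.
  (* If [g] vanished, [gE] would force [(a + 2) * f e = 0]. *)
  have : (a + 2) * f e != 0 by rewrite mulf_neq0.
  rewrite -gE => gn0; apply/existsP; apply: contraNT gn0.
  rewrite negb_exists => /forallP g0; apply/eqP/big1 => x _; apply/eqP.
  by move: (g0 x); rewrite negbK.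
move=> x; rewrite mulrBl {1}/g mulr_sumr.
under [X in _ = X - _]eq_bigr do rewrite -gE.
rewrite (sum_incident_edges (fun s => \sum_(y in s) g y)).
under [X in _ = X - _]eq_bigr => y xy do rewrite big_setU1 ?inE ?adj_neq // big_set1.
by rewrite big_split /= (sumr_adj_regular _ _ Gd) mulr_natl [RHS]addrC addKr.
Qed.

Lemma line_graph_rho {R : realType} {G : sgraph} {d : nat} :
  regular G d -> eigenvalues_ge R G (2 - d%:R) ->
  property_rho R (line_graph G).
Proof.
move=> Gd Gge a /(line_graph_eigenvalue Gd)[//|/Gge]; lra.
Qed.

Lemma rho_eigenvalues_ge {R : realType} {G : sgraph} :
  property_rho R G -> eigenvalues_ge R G (-2).
Proof. by move=> Grho a /Grho; case: (ltrP a 0) => [_ -> //|a0 _]; lra. Qed.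

Lemma regular_eigenvalue_le {R : realType} {G : sgraph} {r : nat} {a : R} :
  regular G r -> eigenvalue (adjacency_matrix R G) a -> a <= r%:R.
Proof.
move=> Gr /eigenvalue_adjacencyP[f [x0 fx0] fa].
(* The bound comes from the eigenvector equation at a vertex where [|f|] is maximal. *)
case: (@arg_maxP _ _ _ x0 xpredT (fun x => `|f x|) erefl) => x _ xmax.
have fx : 0 < `|f x| by rewrite (lt_le_trans _ (xmax x0 _)) ?normr_gt0.
rewrite -(ler_pM2r fx); apply: (@le_trans _ _ `|a * f x|).
  by rewrite normrM ler_wpM2r // ler_norm.
rewrite -fa; apply: le_trans (ler_norm_sum _ _ _) _.
rewrite mulr_natl -(sumr_adj_regular _ x Gr).
by apply: ler_sum => y _; apply: xmax.
Qed.

Lemma complement_regular {G : sgraph} {r : nat} :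
  regular G r -> regular (complement G) (#|G| - 1 - r).
Proof.
move=> Gr x; rewrite -(Gr x) subn1 -(cardsC1 x) -cardsDS.
  by apply: eq_card => y; rewrite !inE /= andbC eq_sym.
by apply/subsetP => y; rewrite !inE eq_sym; apply: adj_neq.
Qed.

(** The two adjacency matrices add up to [J - I], with [J] the all-ones matrix. If [f] sums to 0,
    [J] kills it and [f] is also an eigenvector of [G]. Otherwise, summing the eigenvector equation
    over all vertices forces [a] to be the degree of the complement. *)
Lemma complement_eigenvalue {R : realType} {G : sgraph} {r : nat} {a : R} :
  regular G r -> eigenvalue (adjacency_matrix R (complement G)) a ->
  a = (#|G| - 1 - r)%:R \/ eigenvalue (adjacency_matrix R G) (- 1 - a).
Proof.
move=> Gr /eigenvalue_adjacencyP[f fn0 fa].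
have fS (x : G) : \sum_y f y = f x + \sum_(y | adj x y) f y + a * f x.
  rewrite -fa (bigD1 x) //= -addrA; congr (_ + _).
  rewrite (bigID (adj x)) /=; congr (_ + _); apply: eq_bigl => y; last by rewrite eq_sym.
  by rewrite andbC; case: (boolP (adj x y)) => //= /adj_neq; rewrite eq_sym.
have Sa : a * (\sum_y f y) = (#|G| - 1 - r)%:R * (\sum_y f y).
  rewrite mulr_sumr; under eq_bigr do rewrite -fa.
  rewrite (exchange_big_dep predT) //= mulr_sumr; apply: eq_bigr => y _.
  under eq_bigl do rewrite compl_adj_sym.
  by rewrite (sumr_adj_regular _ _ (complement_regular Gr)) mulr_natl.
have [S0|S0] := eqVneq (\sum_y f y) 0; last by left; apply: (mulIf S0).
right; apply/eigenvalue_adjacencyP; exists f => // x.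
by have := fS x; rewrite S0; lra.
Qed.

Lemma complement_eigenvalues_ge {R : realType} {G : sgraph} {r : nat} :
  regular G r -> eigenvalues_ge R (complement G) (- 1 - r%:R).
Proof.
move=> Gr a /(complement_eigenvalue Gr)[->|].
  have := ler0n R (#|G| - 1 - r); have := ler0n R r; lra.
by move/(regular_eigenvalue_le Gr); lra.
Qed.

Lemma iterated_line_graph_rho {R : realType} {G : sgraph} {d k : nat} :
  regular G d -> (4 <= d)%N -> eigenvalues_ge R G (2 - d%:R) ->
  property_rho R (iterated_line_graph k.+1 G).
Proof.
elim: k G d => [|k IHk] G d Gd d4 Gge; first exact: line_graph_rho Gd Gge.
(* The innermost line graph is peeled off; it satisfies the same hypotheses with degree
   [2 d - 2 >= 6]. *)
rewrite /iterated_line_graph iterSr; apply: (IHk _ _ (line_graph_regular Gd)).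
  lia.
move=> a /(rho_eigenvalues_ge (line_graph_rho Gd Gge)).
(* A degree of at least 4 puts the required bound, 2 minus the degree, at or below -2. *)
have : 4%:R <= (d.*2 - 2)%:R :> R by rewrite ler_nat; lia.
lra.
Qed.

Theorem theorem4p17 (R : realType) (G : sgraph) (n r : nat)
    (order_G : #|G| = n) (regular_G : regular G r)
    (r_ge3 : (3 <= r)%N) (r_le : r%:R <= (n%:R - 1) / 3 :> R) (k : nat)
    (k_ge1 : (1 <= k)%N) :
  property_rho R (iterated_line_graph k (complement G)).
Proof.
have nr : (3 * r + 1 <= n)%N.
  by rewrite -(ler_nat R) natrD natrM; lra.
case: k k_ge1 => // k _.
apply: (iterated_line_graph_rho (complement_regular regular_G)).
  by rewrite order_G; lia.
move=> a /(complement_eigenvalues_ge regular_G); apply: le_trans.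
(* The bound [2 - (n - 1 - r) <= -1 - r] amounts to [2 r + 4 <= n], which follows from
   [3 r + 1 <= n] and [3 <= r]. *)
have : (r + 3)%:R <= (#|G| - 1 - r)%:R :> R by rewrite ler_nat order_G; lia.
rewrite natrD; lra.
Qed.
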